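(* Every quasi-o-minimal densely ordered archimedean group is divisible.
   Context: Structures are $L$-structures $\mathcal{M}=(M,<,\dots)$ for a first-order language $L$ containing $<$, where $<$ is a linear ordering of $M$. ''Definable'' means definable by a first-order formula with parameters; ''0-definable'' means definable without parameters. Intervals may have $\pm\infty$ as endpoints. $\mathcal{M}$ is quasi-o-minimal if for every $\mathcal{N}\equiv\mathcal{M}$ (with universe $N$) the definable subsets of $N$ are exactly the Boolean combinations of 0-definable subsets of $N$ and intervals with endpoints in $N$. A quasi-o-minimal group is a quasi-o-minimal structure which is an ordered group, possibly with extra structure (the order is linear and invariant under left and right multiplication). Densely ordered means that strictly between any two distinct elements there is a third. A group $G$ (written additively) is divisible if $nG=G$ for every positive integer $n$. *)

(* Defs.v *)
From mathcomp Require Import all_boot all_order all_algebra.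
From mathcomp Require Import classical_sets.

Set Implicit Arguments.
Unset Strict Implicit.
Unset Printing Implicit Defensive.

Local Open Scope classical_set_scope.
Local Open Scope group_scope.

(* Constants are the function symbols of arity 0. *)
Record language := Language {
  fun_sym : nat -> Type;
  rel_sym : nat -> Type;
  lt_sym : rel_sym 2
}.

(* A term or formula of type [_ L n] has its free variables among n variables,
   so [formula L 0] is the type of sentences. *)
Inductive term (L : language) (n : nat) : Type :=
| Var of 'I_n
| App k of fun_sym L k & ('I_k -> term L n).

(* In [All phi] the quantified variable is variable 0 of [phi], and variable i
   of the outside context is variable i.+1 of [phi].  The other connectives and
   the existential quantifier are the usual classical abbreviations. *)
Inductive formula (L : language) : nat -> Type :=
| Bot n : formula L n
| Eq n of term L n & term L n : formula L n
| Rel n k of rel_sym L k & ('I_k -> term L n) : formula L n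
| Imp n of formula L n & formula L n : formula L n
| All n of formula L n.+1 : formula L n.

Record structure (L : language) (T : Type) := Structure {
  fun_interp : forall k, fun_sym L k -> k.-tuple T -> T;
  rel_interp : forall k, rel_sym L k -> k.-tuple T -> Prop
}.

Definition scons (T : Type) (n : nat) (a : T) (v : 'I_n -> T) : 'I_n.+1 -> T :=
  fun i => if unlift ord0 i is Some j then v j else a.

Fixpoint eval (L : language) (T : Type) (M : structure L T) (n : nat)
    (v : 'I_n -> T) (t : term L n) : T :=
  match t with
  | Var i => v i
  | App k f ts => fun_interp M f [tuple eval M v (ts i) | i < k]
  end.

Fixpoint sat (L : language) (T : Type) (M : structure L T) (n : nat)
    (phi : formula L n) : ('I_n -> T) -> Prop :=
  match phi in formula _ n return ('I_n -> T) -> Prop with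
  | Bot _ => fun _ => False
  | Eq _ t u => fun v => eval M v t = eval M v u
  | Rel _ k r ts => fun v => rel_interp M r [tuple eval M v (ts i) | i < k]
  | Imp _ phi psi => fun v => sat M phi v -> sat M psi v
  | All _ phi => fun v => forall a : T, sat M phi (scons a v)
  end.

Definition elementarily_equivalent (L : language) (T U : Type)
    (M : structure L T) (N : structure L U) : Prop :=
  forall (phi : formula L 0) (v : 'I_0 -> T) (w : 'I_0 -> U),
    sat M phi v <-> sat N phi w.

(* Variable 0 of [phi] ranges over the set; the others are the parameters. *)
Definition definable (L : language) (T : Type) (M : structure L T)
    (D : set T) : Prop :=
  exists (k : nat) (phi : formula L k.+1) (p : 'I_k -> T),
    D = [set x | sat M phi (scons x p)].

Definition definable0 (L : language) (T : Type) (M : structure L T)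
    (D : set T) : Prop :=
  exists phi : formula L 1, D = [set x | sat M phi (fun=> x)].

Definition slt (L : language) (T : Type) (M : structure L T) (x y : T) : Prop :=
  rel_interp M (lt_sym L) [tuple x; y].

Definition linear_order (T : Type) (lt : T -> T -> Prop) : Prop :=
  [/\ forall x, ~ lt x x,
      forall x y z, lt x y -> lt y z -> lt x z
    & forall x y, [\/ lt x y, x = y | lt y x]].

(* The membership relation of MathComp's formal intervals, for a Prop-valued
   strict order on a bare type.  [BSide true a] (= [BLeft a]) lies just before
   the point a and [BSide false a] (= [BRight a]) just after it; [BInfty _ true]
   is -oo and [BInfty _ false] is +oo. *)
Definition after_bound (T : Type) (lt : T -> T -> Prop) (b : itv_bound T)
    (x : T) : Prop :=
  match b with
  | BSide true a => lt a x \/ a = x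
  | BSide false a => lt a x
  | BInfty true => True
  | BInfty false => False
  end.

Definition interval_set (T : Type) (lt : T -> T -> Prop) (i : interval T) :
    set T :=
  let: Interval l u := i in
  [set x | after_bound lt l x /\ ~ after_bound lt u x].

Inductive boolean_combination (T : Type) (B : set (set T)) : set T -> Prop :=
| BC_base A : B A -> boolean_combination B A
| BC_compl A : boolean_combination B A -> boolean_combination B (~` A)
| BC_union A C : boolean_combination B A -> boolean_combination B C ->
    boolean_combination B (A `|` C)
| BC_inter A C : boolean_combination B A -> boolean_combination B C ->
    boolean_combination B (A `&` C).

Definition quasi_o_minimal (L : language) (T : Type) (M : structure L T) :
    Prop :=
  linear_order (slt M) /\
  forall (U : Type) (N : structure L U), elementarily_equivalent M N ->
    forall D : set U,
      definable N D <->
      boolean_combination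
        [set A | definable0 N A \/ exists i : interval U,
                                     A = interval_set (slt N) i] D.

(* Groups are not assumed commutative, whereas MathComp's additive structures
   are; hence the multiplicative notation here and below. *)
Definition ordered_group (G : groupType) (lt : G -> G -> Prop) : Prop :=
  linear_order lt /\
  forall x y z : G, lt x y -> lt (z * x) (z * y) /\ lt (x * z) (y * z).

Definition densely_ordered (T : Type) (lt : T -> T -> Prop) : Prop :=
  forall x y, lt x y -> exists z, lt x z /\ lt z y.

Definition archimedean (G : groupType) (lt : G -> G -> Prop) : Prop :=
  forall x y : G, lt 1 x -> lt 1 y -> exists n : nat, lt y (x ^+ n).

Definition divisible (G : groupType) : Prop :=
  forall n : nat, 0 < n -> forall x : G, exists y : G, y ^+ n = x.

(* Main.v *)
Require Import Defs.
From mathcomp Require Import all_boot all_order all_algebra.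
From mathcomp Require Import boolp classical_sets filter.

Set Implicit Arguments.
Unset Strict Implicit.
Unset Printing Implicit Defensive.

Local Open Scope classical_set_scope.
Local Open Scope group_scope.

(** Suppose that [a] has no [n]-th root. Then [{x | x^n < a}] is a definable cut
    that no element of [G] realizes, and endpoints of intervals, being elements,
    cannot separate points close to it: near the cut, a Boolean combination of
    intervals and 0-definable sets coincides with a single 0-definable set [E]
    ([boolean_combination_near_cut]). So [E] itself switches from full to empty
    at the missing root of [a].

    One set [E] can do this for infinitely many [a], but only for isolated ones:
    on the interval where [E] agrees with [{x | x^n < a}] it cannot switch at
    another root ([detects_isolated]). Hence finitely many sets [E] detect a
    nowhere dense set of cuts ([finite_detection_nowhere_dense]). On the other
    hand the elements without an [n]-th root are dense ([nonpowers_dense]): the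
    group is commutative, being archimedean, its [n]-th powers are dense, and
    [a] times an [n]-th power is again not an [n]-th power. So every finite
    family of sets misses the cut of some element without [n]-th root.

    Compactness turns this into a contradiction, here through an ultrapower [N]
    of [M] indexed by the finite lists of subsets of [G]. Choose for each list
    [s] an element [a s] without [n]-th root whose cut no member of [s] detects.
    As [N] is elementarily equivalent to [M], quasi-o-minimality gives a
    0-definable set that detects in [N] the cut of the class of [a]. Its
    defining formula defines a set [D] in [M], and by Los's theorem [D] detects
    the cut of [a s] for almost all [s]; but almost all [s] contain [D]. *)

(** * Boolean combinations of intervals near a cut *)

(** In a linear order with [C] an initial segment, [agree_near lt C D E] says
    that [D] and [E] coincide near the cut that [C] determines. *)
Definition agree_near (T : Type) (lt : T -> T -> Prop) (C D E : set T) :=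
  exists l r, [/\ C l, ~ C r & forall x, lt l x -> lt x r -> D x <-> E x].

Section Definable0.
Context (L : language) (T : Type) (M : structure L T).

Lemma definable0C A : definable0 M A -> definable0 M (~` A).
Proof.
by move=> [p ->]; exists (Imp p (Bot L 1)); apply/predeqP => x.
Qed.

Lemma definable0U A B : definable0 M A -> definable0 M B ->
  definable0 M (A `|` B).
Proof.
move=> [p ->] [q ->]; exists (Imp (Imp p (Bot L 1)) q); apply/predeqP => x /=.
split=> [[|]//|]; case: (pselect (sat M p (fun=> x))) => [|np H]; [by left|].
by right; apply: H.
Qed.

Lemma definable0T : definable0 M setT.
Proof. by exists (Imp (Bot L 1) (Bot L 1)); apply/predeqP => x /=; split. Qed.

Context (lt : T -> T -> Prop) (lt_lin : linear_order lt) (C : set T).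
Context (C_lower : exists x, C x) (C_upper : exists x, ~ C x).

(** A finite bound is a point, so it lies on one side of the cut; taking it as
    the endpoint on that side leaves a neighbourhood which it does not split. *)
Lemma after_bound_near (b : itv_bound T) : exists l r (P : Prop),
  [/\ C l, ~ C r & forall x, lt l x -> lt x r -> after_bound lt b x <-> P].
Proof.
have [irr tr tot] := lt_lin.
have [l Cl] := C_lower; have [r Cr] := C_upper.
case: b => [s a|[]]; last 2 first.
- by exists l, r, True.
- by exists l, r, False.
case: (pselect (C a)) => Ca.
  by exists a, r, True; split=> // x ax _; case: s => /=; split=> //; left.
exists l, a, False; split=> // x _ xa; split=> //.
case: s => /= [[ax|ax]|ax]; try exact/irr/(tr _ _ _ xa).
by rewrite ax in xa; apply: irr xa.
Qed.

Lemma common_lower l l' : C l -> C l' -> exists m,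
  C m /\ forall x, lt m x -> lt l x /\ lt l' x.
Proof.
have [irr tr tot] := lt_lin => Cl Cl'.
case: (tot l l') => [ll'|<-|l'l].
- by exists l'; split=> // x l'x; split=> //; exact: tr l'x.
- by exists l.
- by exists l; split=> // x lx; split=> //; exact: tr lx.
Qed.

Lemma common_upper r r' : ~ C r -> ~ C r' -> exists m,
  ~ C m /\ forall x, lt x m -> lt x r /\ lt x r'.
Proof.
have [irr tr tot] := lt_lin => Cr Cr'.
case: (tot r r') => [rr'|<-|r'r].
- by exists r; split=> // x xr; split=> //; exact: tr rr'.
- by exists r.
- by exists r'; split=> // x xr; split=> //; exact: tr r'r.
Qed.

(** Intervals are trivial near a cut, and agreement near a cut is preserved by
    Boolean operations, as are 0-definable sets. *)
Lemma boolean_combination_near_cut D :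
  boolean_combination
    [set A | definable0 M A \/
             exists i : interval T, A = interval_set lt i] D ->
  exists2 E, definable0 M E & agree_near lt C D E.
Proof.
elim=> {D}.
- move=> A [A0|[[b c] ->]].
    have [l Cl] := C_lower; have [r Cr] := C_upper.
    by exists A => //; exists l, r.
  have [l [r [P [Cl Cr bP]]]] := after_bound_near b.
  have [l' [r' [Q [Cl' Cr' cQ]]]] := after_bound_near c.
  have [m [Cm mP]] := common_lower Cl Cl'.
  have [k [Ck kP]] := common_upper Cr Cr'.
  have PQ x : lt m x -> lt x k ->
      interval_set lt (Interval b c) x <-> (P /\ ~ Q).
    move=> /mP[lx l'x] /kP[xr xr'].
    by rewrite /interval_set /= (bP x) // (cQ x).
  case: (pselect (P /\ ~ Q)) => [PnQ|nPQ].
    exists setT; first exact: definable0T.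
    by exists m, k; split=> // x mx xk; rewrite PQ.
  exists (~` setT); first exact/definable0C/definable0T.
  by exists m, k; split=> // x mx xk; rewrite PQ // setCT.
- move=> A _ [E E0 [l [r [Cl Cr AE]]]].
  exists (~` E); first exact: definable0C.
  by exists l, r; split=> // x lx xr; rewrite /setC /= AE.
- move=> A B _ [E E0 [l [r [Cl Cr AE]]]] _ [E' E0' [l' [r' [Cl' Cr' BE]]]].
  have [m [Cm mP]] := common_lower Cl Cl'.
  have [k [Ck kP]] := common_upper Cr Cr'.
  exists (E `|` E'); first exact: definable0U.
  exists m, k; split=> // x /mP[lx l'x] /kP[xr xr'].
  by rewrite /setU /= AE // BE.
- move=> A B _ [E E0 [l [r [Cl Cr AE]]]] _ [E' E0' [l' [r' [Cl' Cr' BE]]]].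
  have [m [Cm mP]] := common_lower Cl Cl'.
  have [k [Ck kP]] := common_upper Cr Cr'.
  exists (~` (~` E `|` ~` E')).
    by apply/definable0C/definable0U; apply: definable0C.
  exists m, k; split=> // x /mP[lx l'x] /kP[xr xr'].
  by rewrite setCU !setCK /setI /= AE // BE.
Qed.

End Definable0.

(** * Powers and cuts in an archimedean dense group *)

Section OrderedGroup.
Context (G : groupType) (lt : G -> G -> Prop) (Glt : ordered_group lt).
Implicit Types (x y z u v a b e h : G) (n : nat).

Lemma lt_irr x : ~ lt x x.
Proof. by case: Glt => -[]. Qed.

Lemma lt_trans x y z : lt x y -> lt y z -> lt x z.
Proof. by case: Glt => -[_ + _ _]; exact. Qed.

Lemma lt_total x y : [\/ lt x y, x = y | lt y x].
Proof. by case: Glt => -[]. Qed.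

Lemma ltM2l z x y : lt x y -> lt (z * x) (z * y).
Proof. by case: Glt => _ /(_ x y z) /[apply] -[]. Qed.

Lemma ltM2r z x y : lt x y -> lt (x * z) (y * z).
Proof. by case: Glt => _ /(_ x y z) /[apply] -[]. Qed.

Lemma ltM x y u v : lt x y -> lt u v -> lt (x * u) (y * v).
Proof. by move=> xy uv; apply: lt_trans (ltM2r u xy) (ltM2l y uv). Qed.

Lemma lt1Vl x y : lt x y -> lt 1 (x^-1 * y).
Proof. by move=> /(ltM2l x^-1); rewrite mulVg. Qed.

Lemma ltX x y n : lt x y -> lt (x ^+ n.+1) (y ^+ n.+1).
Proof.
move=> xy; elim: n => [|n IHn]; first by rewrite !expg1.
by rewrite (expgS x) (expgS y); apply: ltM.
Qed.

Lemma ltX_inv x y n : lt (x ^+ n.+1) (y ^+ n.+1) -> lt x y.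
Proof.
case: (lt_total x y) => [//|->/lt_irr//|yx xyn].
by case: (lt_irr (lt_trans xyn (ltX n yx))).
Qed.

Lemma lt1X e n : lt 1 e -> lt 1 (e ^+ n.+1).
Proof. by move=> /(ltX n); rewrite expg1n. Qed.

Context (lt_dense : densely_ordered lt).

Lemma dense_below2 a x y : lt a x -> lt a y ->
  exists z, [/\ lt a z, lt z x & lt z y].
Proof.
move=> ax ay; case: (lt_total x y) => [xy|<-|yx].
- by have [z [az zx]] := lt_dense ax; exists z; split=> //; exact: lt_trans xy.
- by have [z [az zx]] := lt_dense ax; exists z.
- by have [z [az zy]] := lt_dense ay; exists z; split=> //; exact: lt_trans yx.
Qed.

(** Multiplication is continuous for the order topology of a dense order. *)
Lemma ltM_open x y a : lt (x * y) a ->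
  exists u v, [/\ lt x u, lt y v & lt (u * v) a].
Proof.
move=> /(ltM2r y^-1); rewrite mulgK => /lt_dense[u [xu]].
move=> /(ltM2r y); rewrite mulgVK => /(ltM2l u^-1).
rewrite mulKg => /lt_dense[v [yv]] /(ltM2l u); rewrite mulVKg => uva.
by exists u, v.
Qed.

Lemma ltX_open x a n : lt (x ^+ n.+1) a ->
  exists y, lt x y /\ lt (y ^+ n.+1) a.
Proof.
elim: n a => [|n IHn] a.
  by rewrite expg1 => /lt_dense[y [xy ya]]; exists y; rewrite expg1.
rewrite expgS => /ltM_open[u [v [xu /IHn[y [xy yv]] uva]]].
have [z [xz zu zy]] := dense_below2 xu xy.
exists z; split=> //; apply: lt_trans uva; rewrite expgS; apply: ltM => //.
exact: lt_trans (ltX n zy) yv.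
Qed.

Context (lt_arch : archimedean lt).

Lemma arch_floor e x : lt 1 e -> lt 1 x ->
  exists m, (lt (e ^+ m) x \/ e ^+ m = x) /\ lt x (e ^+ m.+1).
Proof.
move=> e1 x1; have [m] := lt_arch e1 x1.
elim: m => [|m IHm] xm; first by case: (lt_irr (lt_trans x1 xm)).
case: (lt_total (e ^+ m) x) => [mx|mx|/IHm//]; exists m; split=> //.
- by left.
- by right.
Qed.

(** If [x * y = y * x * c] with [c > 1], take [e > 1] with [e ^+ 2 < c]. Locating
    [x] and [y] between consecutive powers of [e] bounds [x * y] above and
    [y * x] below by powers of [e] whose exponents differ by only 2, so that
    [c] cannot exceed [e ^+ 2]. *)
Lemma pos_not_lt_mul x y : lt 1 x -> lt 1 y -> ~ lt (y * x) (x * y).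
Proof.
move=> x1 y1 /lt1Vl; rewrite -[1](expg1n _ 2) => /ltX_open[e [e1 e2c]].
have [m [mx xm]] := arch_floor e1 x1; have [k [ky yk]] := arch_floor e1 y1.
have: lt (y * x * e ^+ 2) (x * y).
  by have := ltM2l (y * x) e2c; rewrite mulVKg.
move=> /lt_trans /(_ (ltM xm yk)).
have -> : e ^+ m.+1 * e ^+ k.+1 = e ^+ k * e ^+ m * e ^+ 2.
  by rewrite -!expgnDr; congr (_ ^+ _); rewrite addn2 addSn addnS addnC.
have [|->] : lt (e ^+ k * e ^+ m) (y * x) \/ e ^+ k * e ^+ m = y * x.
- case: ky mx => [ky|->] [mx|->]; last by right.
  + by left; exact: ltM.
  + by left; exact: ltM2r.
  + by left; exact: ltM2l.
- by move=> /(ltM2r (e ^+ 2))/[swap]/lt_trans/[apply]/lt_irr.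
- exact: lt_irr.
Qed.

Lemma archimedean_commute x y : commute x y.
Proof.
have pos u v : lt 1 u -> lt 1 v -> commute u v.
  move=> u1 v1; case: (lt_total (v * u) (u * v)) => [|//|].
  - by move/(pos_not_lt_mul u1 v1).
  - by move/(pos_not_lt_mul v1 u1).
have inv u : lt u 1 -> lt 1 u^-1 by move=> /lt1Vl; rewrite mulg1.
have half u v : lt 1 u -> commute u v.
  move=> u1; case: (lt_total 1 v) => [/(pos _ _ u1)//|<-|/inv v1].
    exact: commute1.
  by rewrite -[v]invgK; apply/commuteV/pos.
case: (lt_total 1 x) => [/half//|<-|/inv/half x1]; apply/commute_sym.
  exact: commute1.
by rewrite -[x]invgK; apply/commuteV/commute_sym.
Qed.

Lemma arch_bound h x : lt 1 h -> exists k, lt x (h ^+ k).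
Proof.
move=> h1; case: (lt_total 1 x) => [|<-|x1].
- exact: lt_arch.
- by exists 1%N; rewrite expg1.
- by exists 0%N.
Qed.

(** With [h = e ^+ n.+1] smaller than the ratio of the two ends, the powers of
    [h] cannot step over the interval, and they are [n.+1]-th powers. *)
Lemma powers_dense n u v : lt u v ->
  exists g, lt u (g ^+ n.+1) /\ lt (g ^+ n.+1) v.
Proof.
move=> /lt1Vl; rewrite -[1](expg1n _ n.+1) => /ltX_open[e [e1 ec]].
have h1 := lt1X n e1; set h := e ^+ n.+1 in h1 ec.
have hX j : (e ^+ j) ^+ n.+1 = h ^+ j by rewrite expgnAC.
(* Exponents are natural numbers: [u] is first moved above [1] by [h ^+ k]. *)
have [k] := arch_bound u^-1 h1.
move=> /(ltM2l u); rewrite mulgV => /(arch_floor h1)[m [mt tm]].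
exists (e ^+ m.+1 / e ^+ k).
have cee : commute (e ^+ m.+1) (e ^+ k) by apply: commuteX2.
rewrite expgnFl // !hX; split.
  by have := ltM2r (h ^- k) tm; rewrite mulgK.
have -> : h ^+ m.+1 / h ^+ k = h ^+ m / h ^+ k * h.
  rewrite expgSr -!mulgA; congr (_ * _).
  exact/commuteV/commuteX.
have {ec} := ltM2l u ec; rewrite mulVKg.
case: mt => [mt|->]; last by rewrite mulgK.
by apply: lt_trans; apply: ltM2r; have := ltM2r (h ^- k) mt; rewrite mulgK.
Qed.

Definition has_root n a := exists y : G, y ^+ n.+1 = a.

(** The products of [a] with the powers are dense like the powers, and have no
    root because the group is commutative. *)
Lemma nonpowers_dense n a u v : ~ has_root n a -> lt u v ->
  exists b, [/\ ~ has_root n b, lt u b & lt b v].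
Proof.
move=> na /(ltM2r a^-1)/(powers_dense n)[g [ug gv]].
exists (g ^+ n.+1 * a); split.
- move=> [y yga]; apply: na; exists (g^-1 * y).
  rewrite expgMn; last exact: archimedean_commute.
  by rewrite yga expVgn mulKg.
- by have := ltM2r a ug; rewrite mulgVK.
- by have := ltM2r a gv; rewrite mulgVK.
Qed.

(** [D] detects the cut [{x | x ^+ n.+1 < a}] if it looks like this set near
    the place where a root of [a] would be. *)
Definition detects n (D : set G) a :=
  let C := [set x | lt (x ^+ n.+1) a] in agree_near lt C D C.

(** On an interval where [D] looks like the cut of [a], it changes nowhere else,
    while to detect the cut of [b > a] it would have to contain points whose
    powers lie strictly between [a] and [b]. *)
Lemma detects_isolated n (D : set G) a : ~ has_root n a -> detects n D a ->
  exists2 r, lt a r & forall b, lt a b -> lt b r -> ~ detects n D b.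
Proof.
move=> na [l [r [la nra Da]]].
have ar : lt a (r ^+ n.+1).
  by case: (lt_total a (r ^+ n.+1)) => // ar; case: na; exists r.
exists (r ^+ n.+1) => // b ab br [l' [r' [l'b nr'b Db]]].
have [z [az zb l'z]] : exists z, [/\ lt a z, lt z b & lt (l' ^+ n.+1) z].
  case: (lt_total a (l' ^+ n.+1)) => [al|<-|la'].
  - have [z [? ?]] := lt_dense l'b; exists z; split=> //.
    exact: lt_trans al _.
  - by have [z [? ?]] := lt_dense ab; exists z.
  - have [z [? ?]] := lt_dense ab; exists z; split=> //.
    exact: lt_trans la' _.
have [x [zx xb]] := powers_dense n zb.
have ax := lt_trans az zx.
have lx : lt l x by apply/ltX_inv/(lt_trans la ax).
have xr : lt x r by apply/ltX_inv/(lt_trans xb br).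
have l'x : lt l' x by apply/ltX_inv/(lt_trans l'z zx).
have xr' : lt x r'.
  case: (lt_total x r') => [//|xr'|r'x]; case: nr'b; first by rewrite -xr'.
  exact: lt_trans (ltX n r'x) xb.
have /(Da x lx xr) : D x by apply/(Db x l'x xr').
by move=> /(lt_trans ax)/lt_irr.
Qed.

Lemma finite_detection_nowhere_dense n (F : seq (set G)) u v : lt u v ->
  exists u' v', lt u' v' /\
    forall b, ~ has_root n b -> lt u' b -> lt b v' ->
    forall D, D \in F -> ~ detects n D b.
Proof.
elim: F => [|D F IHF] uv; first by exists u, v; split.
have {IHF} [u' [v' [uv' HF]]] := IHF uv.
case: (pselect (exists b,
  [/\ ~ has_root n b, lt u' b, lt b v' & detects n D b])); last first.
  move=> nD; exists u', v'; split=> // b nb ub bv E.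
  rewrite in_cons => /orP[/eqP-> Db|/HF]; last exact.
  by apply: nD; exists b.
move=> [a [na ua av /(detects_isolated na)[r ar Dr]]].
have [w [aw wr wv]] := dense_below2 ar av.
exists a, w; split=> // b nb ab bw E; rewrite in_cons => /orP[/eqP->|EF].
  by apply: Dr => //; exact: lt_trans bw wr.
by apply: HF EF => //; [exact: lt_trans ab | exact: lt_trans wv].
Qed.

Lemma undetected_nonpower n a (F : seq (set G)) : ~ has_root n a ->
  exists b, ~ has_root n b /\ forall D, D \in F -> ~ detects n D b.
Proof.
move=> na.
have [u [v uv]] : exists u v, lt u v.
  case: (lt_total 1 a) => [a1|a1|a1]; [by exists 1, a| |by exists a, 1].
  by case: na; exists 1; rewrite expg1n.
have [u' [v' [uv' HF]]] := finite_detection_nowhere_dense n F uv.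
have [b [nb ub bv]] := nonpowers_dense na uv'.
by exists b; split=> // D; apply: HF.
Qed.

Lemma nonpower_between n a : ~ has_root n a ->
  (exists l, lt (l ^+ n.+1) a) /\ (exists r, lt a (r ^+ n.+1)).
Proof.
move=> na; have [u [v [ua av]]] : exists u v, lt u a /\ lt a v.
  case: (lt_total 1 a) => [a1|a1|a1].
  - by exists 1, (a * a); split=> //; have := ltM2r a a1; rewrite mul1g.
  - by case: na; exists 1; rewrite expg1n.
  - by exists (a * a), 1; split=> //; have := ltM2r a a1; rewrite mul1g.
have [l [_ la]] := powers_dense n ua; have [r [ar _]] := powers_dense n av.
by split; [exists l | exists r].
Qed.

End OrderedGroup.

(** * Ultrapowers *)

Section Ultrapower.
Context (T I : Type) (F : set_system I) (FU : UltraFilter F).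

Lemma ultra_not (P : I -> Prop) : F [set i | ~ P i] <-> ~ F [set i | P i].
Proof.
split=> [FnP FP|nFP].
  by have [i []] := filter_ex (filterI FnP FP).
by have [//|] := in_ultra_setVsetC [set i | P i] FU.
Qed.

Lemma ultra_imp (P Q : I -> Prop) :
  F [set i | P i -> Q i] <-> (F [set i | P i] -> F [set i | Q i]).
Proof.
split=> [FPQ FP|FPQ]; first by apply: filterS2 FPQ FP => i /= PQ /PQ.
case: (pselect (F [set i | P i])) => [/FPQ|/ultra_not]; apply: filterS => i //=.
Qed.

(** From right to left, [f] picks a counterexample wherever there is one. *)
Lemma ultra_forall (P : I -> T -> Prop) :
  F [set i | forall x, P i x] <-> forall f : I -> T, F [set i | P i (f i)].
Proof.
split=> [FP f|FP]; first by apply: filterS FP => i /= /(_ (f i)).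
apply: contrapT => /ultra_not FnP.
have [i0 /= /existsNP[x0 _]] := filter_ex FnP.
have /choice[f fP] : forall i, exists x, ~ (forall x, P i x) -> ~ P i x.
  move=> i; case: (pselect (forall x, P i x)) => [Pi|/existsNP[x Px]].
    by exists x0.
  by exists x.
have Fnf : F [set i | ~ P i (f i)] by apply: filterS FnP => i; apply: fP.
by have [i []] := filter_ex (filterI Fnf (FP f)).
Qed.

(** The class of [f] modulo equality almost everywhere. The ultrapower is the
    type of these classes, so that equality in it is equality almost
    everywhere of representatives. *)
Definition eq_ae (f : I -> T) : set (I -> T) := [set g | F [set i | f i = g i]].

Lemma eq_aeE f g : F [set i | f i = g i] <-> eq_ae f = eq_ae g.
Proof.
split=> [fg|fg]; last first.
  suff : eq_ae f g by [].
  by rewrite fg; apply: filterS filterT.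
apply/predeqP => h; split=> H; last by apply: filterS2 fg H => i /= -> ->.
by apply: filterS2 fg H => i /= -> ->.
Qed.

Definition ultrapower := {A : set (I -> T) | exists f, A = eq_ae f}.

Definition class_of f : ultrapower := exist _ (eq_ae f) (ex_intro _ f erefl).

Definition repr_of (u : ultrapower) : I -> T := projT1 (cid (svalP u)).

Lemma class_ofP f g : class_of f = class_of g <-> F [set i | f i = g i].
Proof.
rewrite eq_aeE; split=> [[]//|fg]; rewrite /class_of.
by apply: eq_exist.
Qed.

Lemma repr_ofK u : class_of (repr_of u) = u.
Proof.
by case: u => A Af; apply: eq_exist; rewrite /repr_of; case: cid => f /= ->.
Qed.

Lemma class_ofK f : F [set i | repr_of (class_of f) i = f i].
Proof. by apply/class_ofP; rewrite repr_ofK. Qed.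

Lemma repr_of_eq u v : F [set i | repr_of u i = repr_of v i] <-> u = v.
Proof. by rewrite -class_ofP !repr_ofK. Qed.

Lemma ultrapower_forall (P : I -> T -> Prop) :
  (forall u, F [set i | P i (repr_of u i)]) -> F [set i | forall x, P i x].
Proof.
move=> FP; apply/ultra_forall => f.
by apply: filterS2 (class_ofK f) (FP (class_of f)) => i /= ->.
Qed.

Context (L : language) (M : structure L T).

Definition ultrapower_structure : structure L ultrapower := {|
  fun_interp k g args :=
    class_of (fun i => fun_interp M g (map_tuple (@repr_of^~ i) args));
  rel_interp k r args :=
    F [set i | rel_interp M r (map_tuple (@repr_of^~ i) args)]
|}.
Local Notation N := ultrapower_structure.

Lemma eval_tuple_ae n k (v : 'I_n -> ultrapower) (ts : 'I_k -> term L n) :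
  (forall j, F [set i | repr_of (eval N v (ts j)) i =
                        eval M (fun m => repr_of (v m) i) (ts j)]) ->
  F [set i | map_tuple (@repr_of^~ i) [tuple eval N v (ts j) | j < k] =
             [tuple eval M (fun m => repr_of (v m) i) (ts j) | j < k]].
Proof.
move=> /filter_forall; apply: filterS => i /= H.
by apply: eq_from_tnth => j; rewrite tnth_map !tnth_mktuple H.
Qed.

Lemma eval_ultrapower n (v : 'I_n -> ultrapower) (t : term L n) :
  F [set i | repr_of (eval N v t) i = eval M (fun j => repr_of (v j) i) t].
Proof.
elim: t => [j|k g ts /eval_tuple_ae IH] /=; first by apply: filterS filterT.
have := class_ofK (fun i => fun_interp M g
  (map_tuple (@repr_of^~ i) [tuple eval N v (ts j) | j < k])).
by apply: filterS2 IH => i /= ->.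
Qed.

Lemma repr_of_scons n u (v : 'I_n -> ultrapower) i :
  (fun j => repr_of (scons u v j) i) =
  scons (repr_of u i) (fun j => repr_of (v j) i).
Proof. by apply/funext => j; rewrite /scons; case: unlift. Qed.

(** Los's theorem: truth in the ultrapower is truth almost everywhere. *)
Lemma los n (phi : formula L n) (v : 'I_n -> ultrapower) :
  sat N phi v <-> F [set i | sat M phi (fun j => repr_of (v j) i)].
Proof.
elim: phi v => {n} /= [n|n t u|n k r ts|n p IHp q IHq|n p IHp] v.
- by split=> // /filter_ex[].
- have Ht := eval_ultrapower v t; have Hu := eval_ultrapower v u.
  rewrite -repr_of_eq; split; apply: filterS3 Ht Hu => i /=.
  + by move=> <- <-.
  + by move=> -> ->.
- have H := eval_tuple_ae (fun j => eval_ultrapower v (ts j)).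
  by split; apply: filterS2 H => i /= ->.
- by rewrite ultra_imp IHp IHq.
- split=> [H|H u].
    apply: ultrapower_forall => u; have /IHp := H u.
    by apply: filterS => i /=; rewrite repr_of_scons.
  by apply/IHp; apply: filterS H => i /=; rewrite repr_of_scons; exact.
Qed.

Lemma ultrapower_equiv : elementarily_equivalent M N.
Proof.
move=> phi v w; rewrite los.
have -> : [set i | sat M phi (fun j => repr_of (w j) i)] =
          [set _ | sat M phi v].
  apply/predeqP => i /=; suff -> : (fun j => repr_of (w j) i) = v by [].
  by apply/funext => -[].
split=> [H|/filter_ex[]//]; by apply: filterS filterT.
Qed.

End Ultrapower.

Lemma slt_ultrapower (T I : Type) (F : set_system I) (FU : UltraFilter F)
  (L : language) (M : structure L T) (u v : ultrapower T F) :
  slt (ultrapower_structure F M) u v <->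
  F [set i | slt M (repr_of u i) (repr_of v i)].
Proof.
rewrite /slt /=.
suff E i : map_tuple (@repr_of _ _ _ ^~ i) [tuple u; v] =
           [tuple repr_of u i; repr_of v i].
  by split; apply: filterS => i /=; rewrite E.
exact: val_inj.
Qed.

Lemma ultrapower_linear (T I : Type) (F : set_system I) (FU : UltraFilter F)
  (L : language) (M : structure L T) :
  linear_order (slt M) -> linear_order (slt (ultrapower_structure F M)).
Proof.
move=> [irr tr tot]; split=> [u|u v w|u v].
- by rewrite slt_ultrapower => /filter_ex[i /irr].
- by rewrite !slt_ultrapower; apply: filterS2 => i; apply: tr.
- set lt := slt _; case: (pselect (lt u v)) => [|nuv]; first by constructor.
  case: (pselect (lt v u)) => [|nvu]; first by constructor.
  apply: Or32; apply/repr_of_eq.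
  move: nuv nvu; rewrite /lt !slt_ultrapower => /(ultra_not FU) nuv /(ultra_not FU).
  apply: filterS2 nuv => i /= nuv nvu.
  by case: (tot (repr_of u i) (repr_of v i)).
Qed.

(** The filter that expresses compactness: a property that holds for all large
    enough finite lists holds almost everywhere. *)
Lemma filter_containing (T : eqType) : exists F : set_system (seq T),
  UltraFilter F /\ forall x, F [set s | x \in s].
Proof.
pose B (s : seq T) := [set s' : seq T | {subset s <= s'}].
have FB : ProperFilter (filter_from setT B).
  apply: filter_from_proper => [|s _]; last by exists s.
  apply: filter_from_filter; first by exists [::].
  move=> s s' _ _; exists (s ++ s') => // s2 ss2.
  by split=> x xs; apply: ss2; rewrite mem_cat xs ?orbT.
have [F [FU BF]] := ultraFilterLemma FB.
exists F; split=> // x; apply: BF; exists [:: x] => // s; apply.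
by rewrite mem_head.
Qed.

(** * Divisibility *)

Lemma eval_pair (L : language) (T : Type) (M : structure L T) m (v : 'I_m -> T)
    (s t : term L m) :
  [tuple eval M v (tnth [tuple s; t] j) | j < 2] =
  [tuple eval M v s; eval M v t].
Proof.
by apply: eq_from_tnth => -[[|[|//]] j2]; rewrite tnth_mktuple.
Qed.

(** The term for [t ^+ n.+1]; the language need not have a symbol for [1]. *)
Definition pow_term (L : language) (op : fun_sym L 2) m (t : term L m) n :
    term L m :=
  iter n (fun s => App op (tnth [tuple t; s])) t.

Lemma eval_pow_term (L : language) (op : fun_sym L 2) (G : groupType)
    (M : structure L G)
    (op_mul : forall x y : G, fun_interp M op [tuple x; y] = x * y)
    m (v : 'I_m -> G) (t : term L m) n :
  eval M v (pow_term op t n) = eval M v t ^+ n.+1.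
Proof.
elim: n => [|n IHn] /=; first by rewrite expg1.
by rewrite eval_pair op_mul IHn -expgS.
Qed.

Theorem theorem9 (L : language) (op : fun_sym L 2) (G : groupType)
    (M : structure L G)
    (op_mul : forall x y : G, fun_interp M op [tuple x; y] = x * y)
    (M_group : ordered_group (slt M))
    (M_qom : quasi_o_minimal M)
    (M_dense : densely_ordered (slt M))
    (M_arch : archimedean (slt M)) :
  divisible G.
Proof.
move=> [//|n] _ x; apply: contrapT => x_nonpower.
have [F [FU F_in]] := filter_containing (set G).
have [a a_nonpower a_undetected] : exists2 a : seq (set G) -> G,
    forall s, ~ has_root n (a s) &
    forall s D, D \in s -> ~ detects (slt M) n D (a s).
  have /choice[a aP] := fun s =>
    undetected_nonpower M_group M_dense M_arch s x_nonpower.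
  by exists a => s; have [] := aP s.
pose N := ultrapower_structure F M.
(* By Los's theorem this is [{u | u ^+ n.+1 < class_of a}] in [N]. *)
pose C : set (ultrapower G F) :=
  [set u | F [set s | slt M (repr_of u s ^+ n.+1) (a s)]].
have C_definable : definable N C.
  exists 1%N, (Rel (lt_sym L) (tnth [tuple pow_term op (Var L ord0) n;
                                     Var L (lift ord0 ord0)])),
    (fun=> class_of F a).
  apply/predeqP => u; split=> [Cu|/(los FU)].
    apply/(los FU); apply: filterS2 (class_ofK FU a) Cu => s /= as_eq.
    rewrite eval_pair (eval_pow_term op_mul) /= /scons unlift_none liftK /=.
    by rewrite as_eq.
  apply: filterS2 (class_ofK FU a) => s /= as_eq.
  rewrite eval_pair (eval_pow_term op_mul) /= /scons unlift_none liftK /=.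
  by rewrite as_eq.
have bounds s := nonpower_between M_group M_dense M_arch (a_nonpower s).
have [l laP] := choice (fun s => (bounds s).1).
have [r raP] := choice (fun s => (bounds s).2).
have C_lower : exists u, C u.
  exists (class_of F l); apply: filterS (class_ofK FU l) => s /= ->.
  exact: laP.
have C_upper : exists u, ~ C u.
  exists (class_of F r) => Cr.
  have [s [/= -> ras]] := filter_ex (filterI (class_ofK FU r) Cr).
  exact: lt_irr M_group _ (lt_trans M_group (raP s) ras).
have [M_linear M_def] := M_qom.
have /(M_def _ N (ultrapower_equiv FU M)) := C_definable.
have N_linear := ultrapower_linear FU M_linear.
move=> /(boolean_combination_near_cut N_linear C_lower C_upper).
move=> [E [phi ->] [u [v [Cu nCv CE]]]].
pose D := [set x | sat M phi (fun=> x)].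
suff : F [set s | detects (slt M) n D (a s)].
  move=> detects_ae.
  have [s [Ds D_detects]] := filter_ex (filterI (F_in D) detects_ae).
  exact: a_undetected Ds D_detects.
have agree_ae : F [set s | forall x, slt M (repr_of u s) x ->
    slt M x (repr_of v s) -> D x <-> slt M (x ^+ n.+1) (a s)].
  apply: (ultrapower_forall FU (P := fun s x => slt M (repr_of u s) x ->
    slt M x (repr_of v s) -> D x <-> slt M (x ^+ n.+1) (a s))) => w.
  apply/(ultra_imp FU) => /(slt_ultrapower FU) uw.
  apply/(ultra_imp FU) => /(slt_ultrapower FU) wv.
  have [CD DC] := CE w uw wv.
  have Da: F [set s | slt M (repr_of w s ^+ n.+1) (a s) -> D (repr_of w s)].
    by apply/(ultra_imp FU) => /CD /(los FU).
  have aD: F [set s | D (repr_of w s) -> slt M (repr_of w s ^+ n.+1) (a s)].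
    by apply/(ultra_imp FU) => Dw; apply/DC/(los FU).
  by apply: filterS2 Da aD => s /= Da aD; split.
move/(ultra_not FU): nCv => nCv.
apply: filterS3 Cu agree_ae nCv => s /= ua agree nva.
by exists (repr_of u s), (repr_of v s).
Qed.
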